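(* Let $\mathcal{F},\mathcal{G}$ be regular thin families and let $N\subseteq\mathbb{N}$ be infinite such that every $t\in\mathcal{G}\upharpoonright N$ is an initial segment of some $s\in\mathcal{F}$. Let $(x_s)_{s\in\mathcal{F}}$ be a bounded $\mathcal{F}$-sequence in a Banach space $X$ such that the $\mathcal{F}$-subsequence $(x_s)_{s\in\mathcal{F}\upharpoonright N}$ is subordinated, and let $\widehat{\varphi}:\widehat{\mathcal{F}}\upharpoonright N\to(X,w)$ be the continuous map witnessing this. For every $v\in\mathcal{G}\upharpoonright N$ let $z_v=\widehat{\varphi}(v)$. Suppose that $(x_s)_{s\in\mathcal{F}\upharpoonright N}$ and $(z_v)_{v\in\mathcal{G}\upharpoonright N}$ generate $(e^1_n)_n$ and $(e^2_n)_n$ as ($\mathcal{F}$- and $\mathcal{G}$-)spreading models respectively. Then for every $k\in\mathbb{N}$ and $a_1,\dots,a_k\in\mathbb{R}$, $$\Big\|\sum_{j=1}^ka_je^2_j\Big\|\le\Big\|\sum_{j=1}^ka_je^1_j\Big\|.$$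
   Context: $\mathbb{N}=\{1,2,\dots\}$. For $M\subseteq\mathbb{N}$ infinite, $M(k)$ is its $k$-th element; for a finite set $s$, $s(k)$ is its $k$-th element; $t\sqsubseteq s$ means initial segment. For a family $\mathcal{F}$ of finite subsets of $\mathbb{N}$ let $\widehat{\mathcal{F}}=\{t:\exists s\in\mathcal{F},\ t\sqsubseteq s\}$, $\mathcal{F}\upharpoonright M=\{s\in\mathcal{F}:s\subseteq M\}$ and $\widehat{\mathcal{F}}\upharpoonright M=\{t\in\widehat{\mathcal{F}}:t\subseteq M\}$. $\mathcal{F}$ is thin if no element is a proper initial segment of another. A family is regular if it is hereditary (closed under subsets), spreading (if $\{n_1<\dots<n_k\}$ is in it, $m_1<\dots<m_k$, $n_i\le m_i$ for all $i$, then $\{m_1,\dots,m_k\}$ is in it) and compact (its characteristic functions form a closed subset of $\{0,1\}^{\mathbb{N}}$). $\mathcal{F}$ is regular thin if it is thin and $\widehat{\mathcal{F}}$ is regular; regular thin families are assumed to contain a nonempty set. A tuple $(s_1,\dots,s_l)$ of nonempty finite subsets of $\mathbb{N}$ is plegma if $s_i(k)<s_j(k)$ whenever $i<j$ and $k\le\min(|s_i|,|s_j|)$, and $s_i(k)<s_j(k+1)$ for all $i,j$ and $k\le\min(|s_i|,|s_j|-1)$. An $\mathcal{F}$-sequence $(x_s)_{s\in\mathcal{F}}$ in $X$ is a map $s\mapsto x_s$ from $\mathcal{F}$ to $X$; an $\mathcal{F}$-subsequence is a family $(x_s)_{s\in\mathcal{F}\upharpoonright M}$ with $M\subseteq\mathbb{N}$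 infinite. $(x_s)_{s\in\mathcal{F}\upharpoonright M}$ is subordinated if there is a continuous map $\widehat{\varphi}:\widehat{\mathcal{F}}\upharpoonright M\to(X,w)$ ($w$ the weak topology, $\widehat{\mathcal{F}}\upharpoonright M$ carrying the topology inherited from $\{0,1\}^{\mathbb{N}}$) such that $\widehat{\varphi}(s)=x_s$ for all $s\in\mathcal{F}\upharpoonright M$; this map is then unique. Let $(e_n)_n$ be a Hamel basis of an infinite-dimensional seminormed space with seminorm $\|\cdot\|_*$ (written simply $\|\cdot\|$ in the claim). $(x_s)_{s\in\mathcal{F}\upharpoonright M}$ generates $(e_n)_n$ as an $\mathcal{F}$-spreading model if there is a null sequence $(\delta_n)_n$ of positive reals such that $\big|\,\|\sum_{j=1}^k a_jx_{s_j}\|-\|\sum_{j=1}^k a_je_j\|_*\big|\le\delta_l$ for all $1\le k\le l$, all plegma $k$-tuples $(s_j)_{j=1}^k$ in $\mathcal{F}\upharpoonright M$ with $s_1(1)\ge M(l)$ and all $a_1,\dots,a_k\in[-1,1]$. *)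

(* Defs.v *)
From HB Require Import structures.
From mathcomp Require Import all_boot all_order all_algebra finmap.
From mathcomp Require Import all_classical all_reals all_analysis.
Set Implicit Arguments.
Unset Strict Implicit.
Unset Printing Implicit Defensive.
Import Order.TTheory GRing.Theory Num.Theory.
Import numFieldNormedType.Exports.
Local Open Scope classical_set_scope.

(* The set {1, 2, ...} is represented by nat, that is, shifted to start at 0;
   every notion below depends only on the order of the index set.  Elements of
   (finite or infinite) sets, members of tuples and terms of sequences are
   likewise numbered from 0. *)

Definition fset_elt (s : {fset nat}) (k : nat) : nat := nth 0 (sort leq s) k.

(* The k-th element of M is the m in M with exactly k elements of M below it;
   it exists and is unique when M is infinite. *)
Definition set_elt (M : set nat) (k : nat) : nat :=
  xget 0 [set m | M m /\ count (fun i => i \in M) (iota 0 m) = k].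

Definition initial_segment (t s : {fset nat}) : Prop :=
  prefix (sort leq t) (sort leq s).

Definition initial_closure (F : set {fset nat}) : set {fset nat} :=
  [set t | exists2 s, F s & initial_segment t s].

Definition restr (F : set {fset nat}) (M : set nat) : set {fset nat} :=
  [set s | F s /\ [set` s] `<=` M].

Definition thin (F : set {fset nat}) : Prop :=
  forall s t, F s -> F t -> initial_segment s t -> s = t.

Definition hereditary (F : set {fset nat}) : Prop :=
  forall s t : {fset nat}, F s -> fsubset t s -> F t.

Definition spreading (F : set {fset nat}) : Prop :=
  forall s t : {fset nat}, F s -> #|` t| = #|` s| ->
    (forall i, i < #|` s| -> fset_elt s i <= fset_elt t i) -> F t.

Definition indicator (s : {fset nat}) : cantor_space := fun n => n \in s.

Definition compact_family (F : set {fset nat}) : Prop :=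
  closed (indicator @` F).

Definition regular (F : set {fset nat}) : Prop :=
  [/\ hereditary F, spreading F & compact_family F].

Definition regular_thin (F : set {fset nat}) : Prop :=
  [/\ thin F, regular (initial_closure F) & exists2 s, F s & s != fset0].

Definition plegma (l : nat) (s : 'I_l -> {fset nat}) : Prop :=
  [/\ forall i, s i != fset0,
      forall (i j : 'I_l) k, i < j -> k < minn #|` s i| #|` s j| ->
        fset_elt (s i) k < fset_elt (s j) k
    & forall (i j : 'I_l) k, k < minn #|` s i| #|` s j|.-1 ->
        fset_elt (s i) k < fset_elt (s j) k.+1].

Local Open Scope ring_scope.

(* Finite sets with the topology inherited from {0,1}^N. *)
Definition fset_space : topologicalType := initial_topology indicator.

(* X with its weak topology: the coarsest topology making all continuous linear
   functionals continuous. *)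
Definition weak_space (R : realType) (X : normedModType R) : topologicalType :=
  sup_topology (fun f : {f : {linear X -> R^o} | continuous f} =>
    Topological.on (initial_topology (sval f))).

Definition subordinated_by (R : realType) (X : normedModType R)
    (F : set {fset nat}) (M : set nat) (x phi : {fset nat} -> X) : Prop :=
  {within (restr (initial_closure F) M : set fset_space),
     continuous (phi : fset_space -> weak_space X)} /\
  (forall s, restr F M s -> phi s = x s).

Definition seminorm (R : realType) (E : lmodType R) (p : E -> R) : Prop :=
  [/\ forall u, 0 <= p u,
      forall u v, p (u + v) <= p u + p v
    & forall a u, p (a *: u) = `|a| * p u].

Definition hamel_basis (R : realType) (E : lmodType R) (e : nat -> E) : Prop :=
  (forall n (a : 'I_n -> R),
     \sum_(i < n) a i *: e i = 0 -> forall i, a i = 0) /\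
  (forall u, exists n (a : 'I_n -> R), u = \sum_(i < n) a i *: e i).

(* Tuples have length k.+1 <= l.+1, so that delta l bounds the error for tuples
   starting beyond the element number l of M. *)
Definition generates_spreading_model (R : realType) (X : normedModType R)
    (F : set {fset nat}) (M : set nat) (x : {fset nat} -> X)
    (E : lmodType R) (p : E -> R) (e : nat -> E) : Prop :=
  exists delta : nat -> R,
    [/\ forall n, 0 < delta n,
        delta @ \oo --> 0
      & forall (k l : nat) (s : 'I_k.+1 -> {fset nat}) (a : 'I_k.+1 -> R),
          (k <= l)%N -> plegma s -> (forall j, restr F M (s j)) ->
          (set_elt M l <= fset_elt (s ord0) 0)%N ->
          (forall j, -1 <= a j <= 1) ->
          `| `|\sum_(j < k.+1) a j *: x (s j)|
             - p (\sum_(j < k.+1) a j *: e j) | <= delta l].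

(* Main.v *)
(* A vector phi(u) with u in the closure of F but not in F is the weak limit of
   phi(u + {n}), so by Mazur's theorem it is norm-close to a convex combination
   of finitely many of these.  As there are finitely many u below a given bound,
   N contains successive finite blocks B_0 < B_1 < ... such that B_r provides
   the vectors phi(u + {n}) needed for every u contained in the earlier blocks,
   with error h / 2^(r+1).  Take tuples (t_0, ..., t_k) whose j-th member has its
   i-th element in B_(i(k+1)+j): such tuples are plegma whatever the lengths of
   their members, and exist in G.  Replacing phi(t_j) by convex combinations
   along the tree of F, one coordinate at a time, bounds |sum a_j phi(t_j)| by
   the supremum of |sum a_j x_(s_j)| over such tuples in F, up to (k+1)h. *)
From HB Require Import structures.
Require Import Defs.
From mathcomp Require Import all_boot all_order all_algebra finmap.
From mathcomp Require Import all_classical all_reals all_analysis.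
From mathcomp Require Import ring lra.
Import Order.TTheory GRing.Theory Num.Theory.
Import numFieldNormedType.Exports.
Local Open Scope classical_set_scope.
Local Open Scope ring_scope.

(** * Sublinear functionals and their linear minorants *)

Definition sublinear {R : realType} {V : lmodType R} (q : V -> R) : Prop :=
  (forall u v, q (u + v) <= q u + q v) /\
  (forall c u, 0 < c -> q (c *: u) <= c * q u).

Lemma sublinearZ {R : realType} {V : lmodType R} (q : V -> R) :
  sublinear q -> forall c u, 0 <= c -> q (c *: u) = c * q u.
Proof.
move=> [_ qZ] c u; rewrite le_eqVlt => /predU1P[<-|c0].
  (* The factors 1/2 and 2 give [q 0 <= q 0 / 2] and [q 0 <= 2 * q 0], so [q 0 = 0]. *)
  rewrite scale0r mul0r; apply/le_anti/andP; split.
    by have := qZ 2^-1 0 ltac:(lra); rewrite scaler0; lra.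
  by have := qZ 2 0 ltac:(lra); rewrite scaler0; lra.
apply/le_anti; rewrite qZ//= -ler_pdivlMl//.
by have := qZ c^-1 (c *: u); rewrite invr_gt0 scalerA mulVf ?gt_eqF// scale1r; apply.
Qed.

Lemma sublinear0 {R : realType} {V : lmodType R} (q : V -> R) :
  sublinear q -> q 0 = 0.
Proof. by move=> /sublinearZ/(_ 0 0 (lexx _)); rewrite scale0r mul0r. Qed.

Lemma sublinear_subN {R : realType} {V : lmodType R} (q : V -> R) :
  sublinear q -> forall u, - q (- u) <= q u.
Proof.
by move=> sq u; have [/(_ u (- u)) + _] := sq; rewrite subrr sublinear0// => ?; lra.
Qed.

(** The pointwise infimum, kept finite by [b], works: sublinearity is asked of the family as a
    whole, with another member allowed to dominate a sum or a multiple. This serves both cones and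
    chains in Zorn's lemma. *)
Lemma inf_sublinear {R : realType} {V : lmodType R} {I : Type} (D : set I)
    (h : I -> V -> R) (b : V -> R) :
  D !=set0 ->
  (forall i v, D i -> b v <= h i v) ->
  (forall i j u v, D i -> D j -> exists2 k, D k & h k (u + v) <= h i u + h j v) ->
  (forall i c u, D i -> 0 < c -> exists2 k, D k & h k (c *: u) <= c * h i u) ->
  exists q, [/\ sublinear q, forall i v, D i -> q v <= h i v
    & forall v m, (forall i, D i -> m <= h i v) -> m <= q v].
Proof.
move=> [i0 Di0] bh hD hZ.
have lb i v : D i -> inf [set h j v | j in D] <= h i v.
  by move=> Di; apply: ge_inf; [exists (b v) => _ [j Dj <-]; exact: bh|exists i].
have glb v m : (forall i, D i -> m <= h i v) -> m <= inf [set h j v | j in D].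
  by move=> mh; apply: lb_le_inf; [exists (h i0 v), i0|move=> _ [j Dj <-]; exact: mh].
exists (fun v => inf [set h i v | i in D]); split => //; split=> [u v|c u c0].
  rewrite -lerBlDr; apply: (glb) => i Di; rewrite lerBlDr -lerBlDl.
  apply: (glb) => j Dj; rewrite lerBlDl.
  by have [k Dk] := hD i j u v Di Dj; apply/le_trans/lb.
rewrite -ler_pdivrMl//; apply: (glb) => i Di; rewrite ler_pdivrMl//.
by have [k Dk] := hZ i c u Di c0; apply/le_trans/lb.
Qed.

(** The infimum over [K] of [q (v + w.1) - w.2] works: at [v = - w.1] the term of [w] is [- w.2]. A
    linear [f] below it satisfies [w.2 <= f w.1] on [K], as in the Hahn-Banach theorem. *)
Lemma sublinear_below_cone {R : realType} {V : lmodType R} (q : V -> R)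
    (K : set (V * R)) :
  sublinear q -> K 0 ->
  (forall w w', K w -> K w' -> K (w + w')) ->
  (forall c w, 0 < c -> K w -> K (c *: w.1, c * w.2)) ->
  (forall w, K w -> w.2 <= q w.1) ->
  exists q', [/\ sublinear q', forall v, q' v <= q v
    & forall w, K w -> q' (- w.1) <= - w.2].
Proof.
move=> sq K0 KD KZ Kq; have [qD qZ] := sq.
have [| | | |q' [sq' q'le _]] :=
    inf_sublinear K (fun w v => q (v + w.1) - w.2) (fun v => - q (- v)).
- by exists 0.
- move=> w v /Kq wq; have := qD (v + w.1) (- v).
  by rewrite addrAC subrr add0r; lra.
- move=> w w' u v Kw Kw'; exists (w + w'); first exact: KD.
  by have := qD (u + w.1) (v + w'.1); rewrite addrACA /=; lra.
- move=> w c u Kw c0; exists (c *: w.1, c * w.2); first exact: KZ.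
  by rewrite mulrBr lerB// -scalerDr; exact: qZ.
exists q'; split => // [v|w Kw].
  by have := q'le _ v K0; rewrite addr0 subr0.
by have := q'le w (- w.1) Kw; rewrite addNr sublinear0// sub0r.
Qed.

(* A minimal sublinear functional below q is linear. *)
Lemma sublinear_minorant {R : realType} {V : lmodType R} (q : V -> R) :
  sublinear q ->
  exists f : {linear V -> R^o}, forall v, f v <= q v.
Proof.
move=> sq.
pose T := {f : V -> R | sublinear f /\ forall v, f v <= q v}.
(* The order is reversed, so that Zorn's lemma yields a minimal functional. *)
pose r (f g : T) := `[< forall v, sval g v <= sval f v >].
have q0 : T by exists q.
have [||[f Pf] [g Pg] /asboolP/= fg /asboolP/= gf|A Atot|m mmin] := @Zorn T r.
- by move=> f; apply/asboolP.
- by move=> f g h /asboolP fg /asboolP gh; apply/asboolP => v; exact: le_trans (fg v).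
- apply/eq_exist/funext => v; apply/le_anti.
  by rewrite fg gf.
- have [->|/set0P[f0 Af0]] := eqVneq A set0; first by exists q0.
  have [| | | |i [si ile _]] := inf_sublinear A (fun f => sval f) (fun v => - q (- v)).
  + by exists f0.
  + move=> f v _; apply: le_trans (sublinear_subN _ (svalP f).1 v).
    by rewrite lerN2 (svalP f).2.
  + move=> f g u v Af Ag.
    have [/asboolP h|/asboolP h] := Atot _ _ Af Ag.
      by exists g => //; rewrite (le_trans ((svalP g).1.1 u v))// lerD.
    by exists f => //; rewrite (le_trans ((svalP f).1.1 u v))// lerD.
  + by move=> f c u Af c0; exists f => //; exact: (svalP f).1.2.
  have iq : sublinear i /\ forall v, i v <= q v.
    by split=> // v; exact: le_trans (ile _ _ Af0) ((svalP f0).2 v).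
  by exists (exist _ i iq) => f Af; apply/asboolP => v; exact: ile.
case: m mmin => m [sm mq] mmin.
(* The cone is the ray through [(v, m v)]: the functional it yields lies below [m], hence equals [m]
   by minimality, and is at most [- m v] at [- v]. *)
have mN v : m (- v) = - m v.
  have [| | | |m' [sm' m'm m'v]] := sublinear_below_cone m
      [set w | exists2 t, 0 <= t & w = (t *: v, t * m v)] sm.
  - by exists 0 => //; rewrite scale0r mul0r.
  - move=> _ _ [t t0 ->] [t' t'0 ->]; exists (t + t'); first exact: addr_ge0.
    by rewrite scalerDl mulrDl.
  - move=> c _ c0 [t t0 ->]; exists (c * t); first exact: mulr_ge0 (ltW c0) t0.
    by rewrite scalerA mulrA.
  - by move=> _ [t t0 ->] /=; rewrite sublinearZ.
  have m'q : sublinear m' /\ forall v, m' v <= q v.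
    by split=> // u; exact: le_trans (m'm u) (mq u).
  have /mmin : r (exist _ m (conj sm mq)) (exist _ m' m'q) by apply/asboolP.
  move=> /(congr1 sval)/= mE.
  apply/le_anti; rewrite -{1}mE lerNl sublinear_subN// andbT.
  have := m'v (1 *: v, 1 * m v); rewrite scale1r mul1r; apply.
  by exists 1 => //; rewrite scale1r mul1r.
(* Oddness turns subadditivity into superadditivity. *)
have mD u v : m (u + v) = m u + m v.
  apply/le_anti; rewrite sm.1/= -lerN2 opprD -!mN opprD; exact: sm.1.
have mlin : linear (m : V -> R^o).
  move=> c u v; rewrite mD; congr (_ + _).
  have [c0|c0] := leP 0 c; first exact: sublinearZ.
  rewrite -[c]opprK scaleNr mN sublinearZ ?oppr_ge0 1?ltW// scaleNr.
  by [].
pose f : {linear V -> R^o} := HB.pack (m : V -> R^o)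
  (@GRing.isLinear.Build R V R^o *:%R (m : V -> R^o) mlin).
by exists f.
Qed.

(** * Mazur's theorem and replacement inside norms *)

(** A convex combination of the [g i] within [eps] of [u] carries a common bound on the
    [a *: g i + y] over to [a *: u + y]; only its finite support [s] has to be remembered. *)
Lemma finite_convex_bound {R : realType} {X : normedModType R} {I : eqType}
    (A : set I) (g : I -> X) (u : X) (eps : R) :
  0 < eps ->
  (forall f : {linear X -> R^o}, continuous f ->
     exists2 i, A i & f (g i) < f u + eps) ->
  exists s : seq I, (forall i, i \in s -> A i) /\
    forall a y c, (forall i, i \in s -> `|a *: g i + y| <= c) ->
      `|a *: u + y| <= c + `|a| * eps.
Proof.
move=> eps0 wcl.
(* Weights are not normalised, so that the pairs [(W s, eps * T s)] form a cone; [|W s| < eps * T s]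
   says that the weighted mean of the [g i] is within [eps] of [u]. *)
pose W (s : seq (R * I)) := \sum_(p <- s) p.1 *: (g p.2 - u).
pose T (s : seq (R * I)) := \sum_(p <- s) p.1.
pose good (s : seq (R * I)) := forall p, p \in s -> 0 <= p.1 /\ A p.2.
(* Otherwise eps separates 0 from the convex hull of the g i - u, and a linear
   minorant of the norm below this cone contradicts the weak convergence. *)
have [[s [sA]]|nex] := pselect (exists s, good s /\ `|W s| < eps * T s).
  move=> Ws; exists (map snd s); split=> [_ /mapP[p /sA[_ Ap] ->] //|a y c sc].
  have T0 : 0 < T s by rewrite -(pmulr_rgt0 _ eps0); exact: le_lt_trans Ws.
  have E : T s *: (a *: u + y) =
      \sum_(p <- s) p.1 *: (a *: g p.2 + y) - a *: W s.
    rewrite /T /W scaler_suml scaler_sumr -sumrB; apply: eq_bigr => p _.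
    rewrite scalerA (mulrC a) -scalerA -scalerBr; congr (_ *: _).
    by rewrite scalerBr opprB [RHS]addrC addrA subrK.
  rewrite -(ler_pM2l T0) -{1}(gtr0_norm T0) -normrZ E.
  apply: (le_trans (ler_normB _ _)); rewrite mulrDr lerD//.
    rewrite mulr_suml (le_trans (ler_norm_sum _ _ _))// !big_seq ler_sum// => p ps.
    have [p0 _] := sA p ps.
    by rewrite normrZ ger0_norm// ler_wpM2l// sc// map_f.
  by rewrite normrZ mulrCA ler_wpM2l// mulrC ltW.
have snorm : sublinear (fun v : X => `|v|).
  by split=> [v w|c v c0]; [exact: ler_normD|rewrite normrZ gtr0_norm].
have [| | | |q [sq qn qA]] := sublinear_below_cone _
    [set w | exists2 s, good s & w = (W s, eps * T s)] snorm.
- by exists nil => //; rewrite /W /T !big_nil mulr0.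
- move=> _ _ [s gs ->] [t gt ->]; exists (s ++ t).
    by move=> p; rewrite mem_cat => /orP[/gs|/gt].
  by rewrite /W /T !big_cat mulrDr.
- move=> c _ c0 [s gs ->]; exists [seq (c * p.1, p.2) | p <- s].
    by move=> _ /mapP[p /gs[p0 Ap] ->]; split=> //; exact: mulr_ge0 (ltW c0) p0.
  rewrite /W /T !big_map/= mulrCA scaler_sumr mulr_sumr; congr (_, eps * _).
  by apply: eq_bigr => p _; rewrite scalerA.
- move=> _ [s gs ->] /=; rewrite leNgt; apply/negP => Ws.
  by apply: nex; exists s.
have [f fq] := sublinear_minorant q sq.
have fn v : `|f v| <= `|v|.
  rewrite ler_norml (le_trans (fq v) (qn v)) andbT lerNl -raddfN -[leRHS]normrN.
  exact: le_trans (fq _) (qn _).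
have fc : continuous f.
  apply/linear_bounded_continuous/linear_boundedP.
  by near=> r => v; apply: (le_trans (fn v)); rewrite ler_peMl.
have [i Ai] := wcl f fc.
(* The single index [i] with weight 1 lies in the cone, so [f (g i) >= f u + eps], against the
   choice of [i]. *)
have : f (- (g i - u)) <= - eps.
  apply: le_trans (fq _) _; apply: (qA (g i - u, eps)).
  exists [:: (1, i)]; first by move=> p; rewrite inE => /eqP ->.
  by rewrite /W /T !big_seq1 scale1r mulr1.
rewrite linearN linearB /= => h1 h2.
by exfalso; move: h1 h2; rewrite opprB; lra.
Unshelve. all: by end_near.
Qed.

(** Summands are replaced one at a time, the others being absorbed into [y]; each replacement costs
    [eps]. *)
Lemma norm_sum_replace {R : realType} {X : normedModType R} (K : nat)
    (A : 'I_K -> set X) (v : 'I_K -> X) (eps : R) :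
  (forall j y c, (forall w, A j w -> `|w + y| <= c) -> `|v j + y| <= c + eps) ->
  forall y c, (forall w : 'I_K -> X, (forall j, A j (w j)) ->
      `|\sum_(j < K) w j + y| <= c) ->
    `|\sum_(j < K) v j + y| <= c + K%:R * eps.
Proof.
elim: K A v => [|K IH] A v vA y c wc.
  by have := wc v ltac:(case=> []//); rewrite !big_ord0 mul0r addr0.
rewrite big_ord_recl -addrA -natr1 mulrDl mul1r [leRHS]addrA.
apply: (vA) => w0 Aw0; rewrite addrCA.
apply: (IH (fun j => A (lift ord0 j))) => [j|w Aw]; first exact: vA.
have := wc (fun j => if unlift ord0 j is Some i then w i else w0).
rewrite big_ord_recl unlift_none -addrA [w0 + _]addrCA.
under eq_bigr do rewrite liftK.
apply=> j; case: unliftP => [i ->|->//]; exact: Aw.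
Qed.

(** * Finite sets extended by a new largest element *)

Lemma sort_fsetU1 (u : {fset nat}) (n : nat) :
  (forall x, x \in u -> (x < n)%N) ->
  sort leq (n |` u)%fset = rcons (sort leq u) n.
Proof.
move=> un; apply: (sorted_eq leq_trans anti_leq).
- exact: sort_sorted leq_total _.
- case: (sort leq u) (sort_sorted leq_total u) (mem_sort leq u) => //= a s.
  rewrite rcons_path => -> mems /=; apply/ltnW/un; rewrite -mems; exact: mem_last.
- rewrite perm_sort perm_sym perm_rcons.
  apply: uniq_perm => /= [||x]; rewrite ?fset_uniq//.
    rewrite sort_uniq fset_uniq andbT mem_sort.
    by apply/negP => /un; rewrite ltnn.
  by rewrite inE mem_sort !inE.
Qed.

Lemma size_sort_fset (u : {fset nat}) : size (sort leq u) = #|` u|.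
Proof. by rewrite size_sort. Qed.

Lemma initial_segment0 (s : {fset nat}) : initial_segment fset0 s.
Proof.
rewrite /initial_segment.
have /size0nil -> : size (sort leq (fset0 : {fset nat})) = 0%N.
  by rewrite size_sort_fset cardfs0.
exact: prefix0s.
Qed.

Lemma card_fsetU1_gt (u : {fset nat}) (n : nat) :
  (forall x, x \in u -> (x < n)%N) -> #|` (n |` u)%fset| = #|` u|.+1.
Proof. by move=> un; rewrite -size_sort_fset sort_fsetU1// size_rcons size_sort. Qed.

Lemma fset_elt_fsetU1 (u : {fset nat}) (n i : nat) :
  (forall x, x \in u -> (x < n)%N) -> (i <= #|` u|)%N ->
  fset_elt (n |` u)%fset i = if (i < #|` u|)%N then fset_elt u i else n.
Proof.
move=> un iu; rewrite /fset_elt sort_fsetU1// nth_rcons size_sort_fset.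
by case: ltngtP iu.
Qed.

Lemma fset_eltP (u : {fset nat}) (x : nat) :
  x \in u -> exists2 i, (i < #|` u|)%N & fset_elt u i = x.
Proof.
rewrite -(mem_sort leq) => /(nthP 0%N)[i iu ix]; exists i => //.
by rewrite -size_sort_fset.
Qed.

(** As [u] is a proper initial segment of some [s] in [F], it can be extended by the next element
    [q] of [s]; spreading then moves [q] up to any larger [n]. *)
Lemma initial_closure_extend (F : set {fset nat}) (u : {fset nat}) :
  regular (initial_closure F) -> initial_closure F u -> ~ F u ->
  exists q, forall n, (q <= n)%N ->
    (forall x, x \in u -> (x < n)%N) /\ initial_closure F (n |` u)%fset.
Proof.
move=> [_ sprF _] [s Fs us] nFu.
have /prefixP[[|q r] sE] := us.
  case: nFu; suff -> : u = s by [].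
  by apply/fsetP => x; rewrite -(mem_sort leq u) -(mem_sort leq s) sE cats0.
have := sort_sorted leq_total s; rewrite sE => /[dup] srt.
have := fset_uniq s; rewrite -(sort_uniq leq) sE cat_uniq /= negb_or.
move=> /and3P[_ /andP[qu _] _].
have uq x : x \in u -> (x < q)%N.
  rewrite -(mem_sort leq) => xu; rewrite ltn_neqAle.
  have -> /= : x != q by apply: contraNneq qu => <-.
  move: srt; rewrite (sorted_pairwise leq_trans) pairwise_cat => /and3P[+ _ _].
  by move=> /allrelP; apply; rewrite ?inE ?eqxx.
have Fq : initial_closure F (q |` u)%fset.
  exists s => //; rewrite /initial_segment sort_fsetU1// sE -cat_rcons.
  exact: prefix_prefix.
move=> _; exists q => n qn.
have un x : x \in u -> (x < n)%N by move=> /uq xq; exact: leq_trans qn.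
split=> //; apply: sprF Fq _ _; first by rewrite !card_fsetU1_gt.
move=> i; rewrite card_fsetU1_gt// ltnS => iu; rewrite !fset_elt_fsetU1//.
by case: ifP.
Qed.

(** * Compactness and convergence of finite sets *)

Lemma cantor_cvgP {T : Type} (Fi : set_system T) (h : T -> cantor_space)
    (l : cantor_space) : Filter Fi ->
  (forall n, \forall i \near Fi, h i n = l n) -> h @ Fi --> l.
Proof.
move=> FF hl; apply/cvg_sup => n U /=.
rewrite (@nbhsE (initial_topology (@^~ n))) => -[_ [[C _ <-] Cl] CU].
by apply: filterS (hl n) => i hi; apply: CU; rewrite /= hi.
Qed.

(** End-extension is well-founded on [H]: the indicators of an infinite chain converge to that of
    its infinite union, whereas a closed family only has limits that are indicators of finite
    sets. *)
Lemma compact_family_ind (H P : set {fset nat}) :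
  compact_family H ->
  (forall u, H u ->
    (forall n, (forall x, x \in u -> (x < n)%N) ->
       H (n |` u)%fset -> P (n |` u)%fset) -> P u) ->
  forall u, H u -> P u.
Proof.
move=> Hc step u Hu; apply: contrapT => nPu.
pose T := {v | H v /\ ~ P v}.
pose rel (v w : T) := exists2 n, (forall x, x \in sval v -> (x < n)%N) &
  sval w = (n |` sval v)%fset.
have [f [_ fS]] : {f : nat -> T |
    f 0%N = exist _ u (conj Hu nPu) /\ forall i, rel (f i) (f i.+1)}.
  apply: dependent_choice => -[v [Hv nPv]]; apply/cid.
  apply: contrapT => nex; apply/nPv/step => // n vn Hnv.
  by apply: contrapT => nP; apply: nex; exists (exist (fun v => H v /\ ~ P v) _ (conj Hnv nP)), n.
have fsub i j : (i <= j)%N -> (sval (f i) `<=` sval (f j))%fset.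
  elim: j => [|j IH]; first by rewrite leqn0 => /eqP ->.
  rewrite leq_eqVlt => /predU1P[->//|/IH]; have [n _ ->] := fS j.
  by move=> /fsubset_trans; apply; exact: fsubsetUr.
have fcard i : (i <= #|` sval (f i)|)%N.
  elim: i => // i IH; have [n fn ->] := fS i.
  by rewrite card_fsetU1_gt.
pose l : cantor_space := fun n => `[< exists i, n \in sval (f i) >].
have fl : (indicator \o (fun i => sval (f i))) @ \oo --> l.
  apply: cantor_cvgP => n; rewrite /l /indicator /=.
  have [[i0 ni0]|nex] := pselect (exists i, n \in sval (f i)).
    exists i0 => // i /= /fsub/fsubsetP/(_ _ ni0) ->.
    by apply/esym/asboolP; exists i0.
  exists 0%N => // i _ /=; rewrite asboolF//.
  by apply/negP => ni; apply: nex; exists i.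
have [s Hs sl] : (indicator @` H) l.
  apply: Hc => B /fl[i _ /(_ i (leqnn i)) Bi].
  exists (indicator (sval (f i))); split=> //.
  by exists (sval (f i)) => //; exact: (svalP (f i)).1.
(* The member of the chain with index [#|s| + 1] has more elements than [s], yet is contained in
   it. *)
have := fcard (#|` s|.+1); rewrite leqNgt ltnS fsubset_leq_card//.
apply/fsubsetP => x xf; rewrite -[_ \in s]/(indicator s x) sl.
by apply/asboolP; exists (#|` s|.+1).
Qed.

Lemma fset_space_cvg (u : {fset nat}) :
  (fun n => (n |` u)%fset : fset_space) @ \oo --> (u : fset_space).
Proof.
move=> U /=; rewrite (@nbhsE fset_space) => -[_ [[C oC <-] Cu] CU].
have /(_ C) : (indicator \o (fun n => (n |` u)%fset)) @ \oo --> indicator u.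
  apply: cantor_cvgP => x; exists x.+1 => // n /= xn.
  by rewrite /indicator !inE; case: eqP xn => [->|//]; rewrite ltnn.
case; first exact: open_nbhs_nbhs.
by move=> n _ nC; exists n => // m /nC; exact: CU.
Qed.

Lemma subordinated_by_cvg {R : realType} {X : normedModType R}
    (F : set {fset nat}) (M : set nat) (x phi : {fset nat} -> X)
    (u : {fset nat}) (f : {linear X -> R^o}) (e : R) :
  subordinated_by F M x phi -> restr (initial_closure F) M u ->
  continuous f -> 0 < e ->
  exists q, forall n, (q <= n)%N ->
    restr (initial_closure F) M (n |` u)%fset ->
    f (phi (n |` u)%fset) < f (phi u) + e.
Proof.
move=> [/subspace_continuousP/(_ u) + _] Hu fc e0 => /(_ Hu).
move=> /cvg_sup/(_ (exist _ f fc)) phic.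
have S : nbhs (phi u : initial_topology f) [set w | f w < f (phi u) + e].
  apply: (@initial_continuous X R^o f (phi u) [set r | r < f (phi u) + e]).
  by apply: lt_nbhsl; rewrite ltrDl.
have /fset_space_cvg[q _ qS] := phic _ S.
by exists q => n /qS; apply.
Qed.

(** * Successive blocks and threaded sets *)

Lemma finite_uniform {T : eqType} (s : seq T) (P : T -> nat -> Prop) :
  (forall u m n, (m <= n)%N -> P u m -> P u n) ->
  (forall u, u \in s -> exists n, P u n) ->
  exists n, forall u, u \in s -> P u n.
Proof.
move=> Pmono; elim: s => [_|v s IH sP]; first by exists 0%N.
have [u us|m mP] := IH; first by apply: sP; rewrite inE us orbT.
have [n nP] := sP v (mem_head v s).
exists (maxn m n) => u; rewrite inE => /predU1P[->|/mP].
  by apply: Pmono nP; exact: leq_maxr.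
by apply: Pmono; exact: leq_maxl.
Qed.

Lemma infinite_set_ge (N : set nat) (q : nat) :
  infinite_set N -> exists2 n, N n & (q <= n)%N.
Proof.
move=> Ninf; apply: contrapT => nex; apply: Ninf.
apply: sub_finite_set (finite_II q) => n Nn /=.
by rewrite ltnNge; apply/negP => qn; apply: nex; exists n.
Qed.

(** Recursion: once the earlier blocks lie below [m], the next window is chosen beyond [m] and suits
    every [u] below [m], in particular every [u] drawn from earlier blocks. *)
Lemma exists_blocks (N : set nat) (b : nat)
    (Q : nat -> {fset nat} -> set nat -> Prop) :
  (forall r m, exists lo hi, [/\ (m <= lo)%N,
     exists2 n, N n & (lo <= n < hi)%N
   & forall u : {fset nat}, (forall x, x \in u -> (x < m)%N) ->
       Q r u [set n | N n /\ (lo <= n < hi)%N]]) ->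
  exists B : nat -> set nat, [/\ forall r, B r !=set0,
    forall r n, B r n -> N n /\ (b <= n)%N,
    forall r r' n n', (r < r')%N -> B r n -> B r' n' -> (n < n')%N
  & forall r u, (forall x, x \in u -> exists2 r', (r' < r)%N & B r' x) ->
      Q r u (B r)].
Proof.
move=> step.
have /choice[g gP] : forall rm : nat * nat, exists lohi : nat * nat,
    [/\ (rm.2 <= lohi.1)%N,
     exists2 n, N n & (lohi.1 <= n < lohi.2)%N
   & forall u : {fset nat}, (forall x, x \in u -> (x < rm.2)%N) ->
       Q rm.1 u [set n | N n /\ (lohi.1 <= n < lohi.2)%N]].
  by move=> [r m]; have [lo [hi ?]] := step r m; exists (lo, hi).
(* [start r] is the exclusive upper end of the previous block; starting at [b] keeps all blocks
   beyond [b]. *)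
pose start := fix start r := if r is r'.+1 then (g (r', start r')).2 else b.
pose B r := [set n | N n /\ ((g (r, start r)).1 <= n < (g (r, start r)).2)%N].
have startS r : (start r <= (g (r, start r)).1)%N /\
    ((g (r, start r)).1 <= start r.+1)%N.
  by have [h [n _ /andP[/leq_trans h1 /ltnW/h1]]] := gP (r, start r).
have start_mono r r' : (r <= r')%N -> (start r <= start r')%N.
  move=> /subnK <-; elim: (r' - r)%N => //= k IH; apply: leq_trans IH _.
  by have [h1 h2] := startS (k + r)%N; exact: leq_trans h1 h2.
have Bstart r n : B r n -> (start r <= n < start r.+1)%N.
  by move=> [_ /andP[h1 h2]]; rewrite h2 andbT (leq_trans _ h1)// (startS r).1.
exists B; split=> [r|r n Brn|r r' n n' rr' /Bstart/andP[_ h1] /Bstart/andP[h2 _]|r u ur].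
- by have [_ [n Nn hn] _] := gP (r, start r); exists n.
- split; first by case: Brn.
  by have /andP[h _] := Bstart _ _ Brn; apply: leq_trans h; exact: (start_mono 0%N).
- exact: leq_trans h1 (leq_trans (start_mono _ _ rr') h2).
- have [_ _] := gP (r, start r); apply=> x /ur[r' rr' /Bstart/andP[_ h]].
  exact: leq_trans h (start_mono _ _ rr').
Qed.

(* The [threaded B K j] sets, for [j < K], interlace: the elements of a K-tuple of
   them occupy the blocks in the order s_0(0), s_1(0), ..., s_0(1), s_1(1), ... *)
Definition threaded (B : nat -> set nat) (K j : nat) (u : {fset nat}) : Prop :=
  forall i, (i < #|` u|)%N -> B (i * K + j)%N (fset_elt u i).

Lemma threaded0 (B : nat -> set nat) (K j : nat) : threaded B K j fset0.
Proof. by move=> i; rewrite cardfs0. Qed.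

Lemma threaded_mem (B : nat -> set nat) (K j : nat) (u : {fset nat}) (x : nat) :
  threaded B K j u -> x \in u -> exists2 i, (i < #|` u|)%N & B (i * K + j)%N x.
Proof. by move=> Bu /fset_eltP[i iu <-]; exists i => //; exact: Bu. Qed.

Lemma threaded_below (B : nat -> set nat) (K j : nat) (u : {fset nat}) (x : nat) :
  (0 < K)%N -> threaded B K j u -> x \in u ->
  exists2 r, (r < #|` u| * K + j)%N & B r x.
Proof.
move=> K0 Bu /(threaded_mem _ _ _ _ _ Bu)[i iu Bx].
by exists (i * K + j)%N => //; rewrite ltn_add2r ltn_pmul2r.
Qed.

Lemma threaded_fsetU1 (B : nat -> set nat) (K j : nat) (u : {fset nat}) (n : nat) :
  (forall x, x \in u -> (x < n)%N) -> threaded B K j u ->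
  B (#|` u| * K + j)%N n -> threaded B K j (n |` u)%fset.
Proof.
move=> un Bu Bn i; rewrite card_fsetU1_gt// ltnS => iu.
rewrite fset_elt_fsetU1//; case: ltnP => [|ui]; first exact: Bu.
by have -> : i = #|` u| by apply/eqP; rewrite eqn_leq iu.
Qed.

(** Block indices compare as required: [k * K + i < k * K + j] for [i < j], and
    [k * K + i < k.+1 * K + j] because [i < K]. *)
Lemma threaded_plegma (B : nat -> set nat) (K : nat) (s : 'I_K -> {fset nat}) :
  (forall r r' n n', (r < r')%N -> B r n -> B r' n' -> (n < n')%N) ->
  (forall j, s j != fset0) -> (forall j : 'I_K, threaded B K j (s j)) -> plegma s.
Proof.
move=> Blt s0 sB; split=> // i j k.
  move=> ij; rewrite leq_min => /andP[ki kj].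
  by apply: Blt (sB i k ki) (sB j k kj); rewrite ltn_add2l.
rewrite leq_min ltn_predRL => /andP[ki kj].
apply: Blt (sB i k ki) (sB j k.+1 kj).
by rewrite mulSn addnAC -[ltnLHS]addnC ltn_add2r ltn_addr.
Qed.

(** From the empty set on, a point of the prescribed block is added until [G] is reached;
    compactness makes this stop. *)
Lemma threaded_exists (G : set {fset nat}) (B : nat -> set nat) (K j : nat) :
  (0 < K)%N -> regular_thin G -> (forall r, B r !=set0) ->
  (forall r u, (forall x, x \in u -> exists2 r', (r' < r)%N & B r' x) ->
     initial_closure G u -> ~ G u -> forall n, B r n ->
     (forall x, x \in u -> (x < n)%N) /\ initial_closure G (n |` u)%fset) ->
  exists2 t, G t & threaded B K j t.
Proof.
move=> K0 [_ [_ _ cG] [s0 Gs0 _]] B0 BG.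
pose P := [set u | threaded B K j u -> exists2 t, G t & threaded B K j t].
have : P fset0; last by apply; exact: threaded0.
apply: (compact_family_ind _ P cG) => [u Gu IH Bu|]; last first.
  by exists s0 => //; exact: initial_segment0.
have [|nGu] := pselect (G u); first by exists u.
have [n Bn] := B0 (#|` u| * K + j)%N.
have [un Gn] := BG _ _ (fun x => threaded_below _ _ _ _ x K0 Bu) Gu nGu n Bn.
exact: IH n un Gn (threaded_fsetU1 _ _ _ _ _ un Bu Bn).
Qed.

(** Induction from the members of [F] down to [u]: each vector is replaced by those of its one-point
    extensions in the next block, and the errors sum geometrically. *)
Lemma threaded_bound {R : realType} {X : normedModType R}
    (F : set {fset nat}) (N : set nat) (phi : {fset nat} -> X)
    (B : nat -> set nat) (K j : nat) (eps : R) :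
  0 < eps -> (0 < K)%N -> compact_family (initial_closure F) ->
  (forall r n, B r n -> N n) ->
  (forall r u, (forall x, x \in u -> exists2 r', (r' < r)%N & B r' x) ->
     restr (initial_closure F) N u -> ~ F u ->
     (forall n, B r n -> (forall x, x \in u -> (x < n)%N) /\
                         restr (initial_closure F) N (n |` u)%fset) /\
     (forall a y c, (forall n, B r n -> `|a *: phi (n |` u)%fset + y| <= c) ->
        `|a *: phi u + y| <= c + `|a| * (eps / 2 ^+ r.+1))) ->
  forall u, initial_closure F u -> threaded B K j u ->
  forall a y c, `|a| <= 1 ->
    (forall s, F s -> threaded B K j s -> `|a *: phi s + y| <= c) ->
    `|a *: phi u + y| <= c + eps.
Proof.
move=> eps0 K0 cF BN BF u Fu Bu a y c a1 sc.
(* The allowance [eps / 2 ^+ #|u|] is halved at each extension; the other half pays for the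
   replacement at [u]. *)
pose P := [set u | threaded B K j u -> `|a *: phi u + y| <= c + eps / 2 ^+ #|` u|].
have : P u; last first.
  move=> /(_ Bu)/le_trans; apply; rewrite lerD2l ler_pdivrMr ?exprn_gt0//.
  by rewrite ler_peMr ?(ltW eps0)// exprn_ege1// ler1n.
apply: (compact_family_ind _ P cF) Fu => {u Bu} u Fu IH Bu.
have [Fs|nFu] := pselect (F u).
  by apply: le_trans (sc _ Fs Bu) _; rewrite lerDl divr_ge0 ?exprn_ge0// ltW.
have Nu : restr (initial_closure F) N u.
  by split=> // x /= /(threaded_mem _ _ _ _ _ Bu)[i _]; exact: BN.
have [next bnd] := BF _ _ (fun x => threaded_below _ _ _ _ x K0 Bu) Nu nFu.
have : `|a *: phi u + y| <= c + eps / 2 ^+ #|` u|.+1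
    + `|a| * (eps / 2 ^+ (#|` u| * K + j)%N.+1).
  apply: bnd => n Bn; have [un [Fn _]] := next n Bn.
  by rewrite -(card_fsetU1_gt _ _ un); exact: IH n un Fn (threaded_fsetU1 _ _ _ _ _ un Bu Bn).
move=> /le_trans; apply; rewrite -addrA lerD2l.
have -> : eps / 2 ^+ #|` u| = eps / 2 ^+ #|` u|.+1 + eps / 2 ^+ #|` u|.+1.
  by rewrite exprS; field; rewrite expf_neq0.
(* Since [K > 0], the block index [#|u| * K + j] is at least [#|u|], so its error fits into the
   spare half. *)
rewrite lerD2l -[leRHS]mul1r ler_pM// ?divr_ge0 ?exprn_ge0 ?(ltW eps0)//.
rewrite ler_pM2l// lef_pV2 ?posrE ?exprn_gt0// ler_weXn2l ?ler1n//.
by rewrite ltnS (leq_trans _ (leq_addr _ _))// leq_pmulr.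
Qed.

(** * Windows of [N] suited to both families *)

(** The empty set is an initial segment of the nonempty member, so thinness excludes it. *)
Lemma regular_thin_neq0 (F : set {fset nat}) (s : {fset nat}) :
  regular_thin F -> F s -> s != fset0.
Proof.
move=> [thF _ [s0 Fs0 s0n]] Fs; apply: contraNneq s0n => sE; rewrite -sE.
apply/eqP/esym/thF => //; rewrite sE; exact: initial_segment0.
Qed.

Lemma restr_fsetU1 (F : set {fset nat}) (N : set nat) (u : {fset nat}) (n : nat) :
  restr F N u -> N n -> F (n |` u)%fset -> restr F N (n |` u)%fset.
Proof.
move=> [_ uN] Nn Fn; split=> // x /=; rewrite !inE => /predU1P[->//|]; exact: uN.
Qed.

Lemma finite_window {R : realType} {X : normedModType R}
    (F : set {fset nat}) (N : set nat) (x phi : {fset nat} -> X)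
    (u : {fset nat}) (eps : R) (lo : nat) :
  infinite_set N -> subordinated_by F N x phi -> 0 < eps ->
  restr (initial_closure F) N u ->
  (forall n, (lo <= n)%N -> initial_closure F (n |` u)%fset) ->
  exists hi, forall a y c,
    (forall n, N n /\ (lo <= n < hi)%N -> `|a *: phi (n |` u)%fset + y| <= c) ->
    `|a *: phi u + y| <= c + `|a| * eps.
Proof.
move=> Ninf sub eps0 Nu uF.
have [f fc|s [sN sP]] := finite_convex_bound [set n | N n /\ (lo <= n)%N]
    (fun n => phi (n |` u)%fset) (phi u) eps eps0.
  have [q qP] := subordinated_by_cvg _ _ _ _ _ _ _ sub Nu fc eps0.
  have [n Nn] := infinite_set_ge N (maxn lo q) Ninf.
  rewrite geq_max => /andP[lon qn]; exists n => //.
  by apply: qP => //; apply: restr_fsetU1 => //; exact: uF.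
exists (\max_(n <- s) n).+1 => a y c h; apply: sP => n ns; apply: h.
have [Nn lon] := sN n ns; split=> //; rewrite lon ltnS.
exact: (@leq_bigmax_seq _ s predT id n ns isT).
Qed.

(** The requirement on a block [C]: the [G] half serves to build the tuple, the [F] half to replace
    [phi u] by the vectors of its extensions. *)
Definition extension_block {R : realType} {X : normedModType R}
    (F G : set {fset nat}) (N : set nat) (phi : {fset nat} -> X) (eps : R)
    (u : {fset nat}) (C : set nat) : Prop :=
  (initial_closure G u -> ~ G u -> forall n, C n ->
     (forall i, i \in u -> (i < n)%N) /\ initial_closure G (n |` u)%fset) /\
  (restr (initial_closure F) N u -> ~ F u ->
     (forall n, C n -> (forall i, i \in u -> (i < n)%N) /\
                       restr (initial_closure F) N (n |` u)%fset) /\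
     (forall a y c, (forall n, C n -> `|a *: phi (n |` u)%fset + y| <= c) ->
        `|a *: phi u + y| <= c + `|a| * eps)).

(** Only finitely many [u] lie below [m], and their individual thresholds persist when increased, so
    common [lo] and [hi] exist. *)
Lemma exists_window {R : realType} {X : normedModType R}
    (F G : set {fset nat}) (N : set nat) (x phi : {fset nat} -> X)
    (eps : R) (m : nat) :
  regular_thin F -> regular_thin G -> infinite_set N ->
  subordinated_by F N x phi -> 0 < eps ->
  exists lo hi, [/\ (m <= lo)%N, exists2 n, N n & (lo <= n < hi)%N
  & forall u : {fset nat}, (forall i, i \in u -> (i < m)%N) ->
      extension_block F G N phi eps u [set n | N n /\ (lo <= n < hi)%N]].
Proof.
move=> [_ rF _] [_ rG _] Ninf sub eps0.
pose U := fpowerset [fset i in iota 0 m]%fset.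
have inU (u : {fset nat}) : (forall i, i \in u -> (i < m)%N) -> u \in U.
  by move=> um; rewrite fpowersetE; apply/fsubsetP => i /um; rewrite !inE mem_iota.
pose ext (H : set {fset nat}) (u : {fset nat}) (lo : nat) :=
  initial_closure H u -> ~ H u -> forall n, (lo <= n)%N ->
    (forall i, i \in u -> (i < n)%N) /\ initial_closure H (n |` u)%fset.
have ext_mono H u i j : (i <= j)%N -> ext H u i -> ext H u j.
  by move=> ij h Hu nHu n jn; exact: h Hu nHu n (leq_trans ij jn).
have ext_ex H u : regular (initial_closure H) -> exists lo, ext H u lo.
  move=> rH; have [[Hu nHu]|no] := pselect (initial_closure H u /\ ~ H u).
    by have [q qP] := initial_closure_extend H u rH Hu nHu; exists q => _ _.
  by exists 0%N => Hu nHu; case: no.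
have [loF loFP] := finite_uniform U (ext F) (ext_mono F) (fun u _ => ext_ex F u rF).
have [loG loGP] := finite_uniform U (ext G) (ext_mono G) (fun u _ => ext_ex G u rG).
pose lo := maxn m (maxn loF loG).
have [hi hiP] : exists hi, forall u, u \in U ->
    restr (initial_closure F) N u -> ~ F u -> forall a y c,
    (forall n, N n /\ (lo <= n < hi)%N -> `|a *: phi (n |` u)%fset + y| <= c) ->
    `|a *: phi u + y| <= c + `|a| * eps.
  apply: (finite_uniform U (fun u hi => restr (initial_closure F) N u -> ~ F u ->
    forall a y c, (forall n, N n /\ (lo <= n < hi)%N ->
      `|a *: phi (n |` u)%fset + y| <= c) ->
    `|a *: phi u + y| <= c + `|a| * eps)) => [u i j ij h Nu nFu a y c hc|u uU].
    apply: h => // n [Nn /andP[lon ni]]; apply: hc; split=> //.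
    by rewrite lon (leq_trans ni ij).
  have [[Nu nFu]|no] := pselect (restr (initial_closure F) N u /\ ~ F u); last first.
    by exists 0%N => Nu nFu; case: no.
  have [n lon|hi hiP] := finite_window F N x phi u eps lo Ninf sub eps0 Nu.
    have [] // := loFP u uU Nu.1 nFu n.
    by apply: leq_trans lon; rewrite /lo !leq_max leqnn orbT.
  by exists hi => _ _.
have [n0 Nn0 lon0] := infinite_set_ge N lo Ninf.
(* Including [n0] makes the window meet [N]. *)
exists lo, (maxn hi n0.+1); split; first exact: leq_maxl.
  by exists n0 => //; rewrite lon0 leq_max ltnSn orbT.
move=> u /inU uU; split=> [Gu nGu n [_ /andP[lon _]]|Nu nFu].
  by apply: loGP => //; apply: leq_trans lon; rewrite /lo !leq_max leqnn !orbT.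
split=> [n [Nn /andP[lon _]]|a y c hc].
  have [|un Fn] := loFP u uU Nu.1 nFu n.
    by apply: leq_trans lon; rewrite /lo !leq_max leqnn orbT.
  by split=> //; exact: restr_fsetU1.
apply: hiP => // n [Nn /andP[lon nhi]]; apply: hc; split=> //.
by rewrite lon leq_max nhi.
Qed.

(** * Comparison of the two spreading models *)

Lemma spreading_model_le {R : realType} {X : normedModType R}
    (F G : set {fset nat}) (N : set nat) (x phi z : {fset nat} -> X)
    (E1 E2 : lmodType R) (p1 : E1 -> R) (p2 : E2 -> R)
    (e1 : nat -> E1) (e2 : nat -> E2) (k : nat) (a : 'I_k.+1 -> R) :
  regular_thin F -> regular_thin G -> infinite_set N ->
  (forall t, restr G N t -> initial_closure F t) ->
  subordinated_by F N x phi ->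
  (forall v, restr G N v -> z v = phi v) ->
  generates_spreading_model F N x p1 e1 ->
  generates_spreading_model G N z p2 e2 ->
  (forall j, -1 <= a j <= 1) ->
  p2 (\sum_(j < k.+1) a j *: e2 j) <= p1 (\sum_(j < k.+1) a j *: e1 j).
Proof.
move=> rF rG Ninf GF sub zphi [d1 [_ d1c gen1]] [d2 [_ d2c gen2]] a1.
(* The error [e] is [k + 3] times [h]: one [h] for each spreading model and [k + 1] for the replaced
   coordinates. *)
apply/ler_addgt0Pr => e e0; pose h := e / (k.+3)%:R.
have h0 : 0 < h by rewrite divr_gt0.
have small (d : nat -> R) : d @ \oo --> 0 -> \forall l \near \oo, d l < h.
  by move=> /cvgr_lt; exact.
have [l [kl d1l d2l]] : exists l, [/\ (k <= l)%N, d1 l < h & d2 l < h].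
  have [l _ lP] : \forall l \near \oo, [/\ (k <= l)%N, d1 l < h & d2 l < h].
    near=> l; split; near: l; [exact: nbhs_infty_ge|exact: small|exact: small].
  by exists l; exact: (lP l (leqnn l)).
have h2 r : 0 < h / 2 ^+ r.+1 by rewrite divr_gt0// exprn_gt0.
(* Blocks begin at element [l] of [N], so that tuples drawn from them satisfy both generating
   estimates with error below [h]. *)
have [B [B0 BN Blt BP]] := exists_blocks N (set_elt N l)
  (fun r => extension_block F G N phi (h / 2 ^+ r.+1))
  (fun r m => exists_window F G N x phi _ m rF rG Ninf sub (h2 r)).
have thr_restr (H : set {fset nat}) (j : nat) (s : {fset nat}) :
    H s -> threaded B k.+1 j s -> restr H N s.
  by move=> Hs sB; split=> // i /= /(threaded_mem _ _ _ _ _ sB)[r _ /BN[]].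
have thr_start (s : 'I_k.+1 -> {fset nat}) : (forall j, s j != fset0) ->
    (forall j : 'I_k.+1, threaded B k.+1 j (s j)) ->
    (set_elt N l <= fset_elt (s ord0) 0)%N.
  move=> s0 sB; have := sB ord0 0%N; rewrite cardfs_gt0 s0 => /(_ isT).
  by case/BN.
have /choice[t tP] : forall j : 'I_k.+1, exists t, G t /\ threaded B k.+1 j t.
  move=> j.
  have [r u ur Gu nGu|t Gt tB] := threaded_exists G B k.+1 j (ltn0Sn k) rG B0.
    exact: (BP r u ur).1.
  by exists t.
have GN j : restr G N (t j) by case: (tP j) => Gt tB; exact: thr_restr Gt tB.
have tplegma : plegma t.
  by apply: (threaded_plegma B) => // j; [apply: regular_thin_neq0 rG _|]; case: (tP j).
have lower : p2 (\sum_(j < k.+1) a j *: e2 j)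
    <= `|\sum_(j < k.+1) a j *: phi (t j)| + h.
  have : (set_elt N l <= fset_elt (t ord0) 0)%N.
    by apply: thr_start => j; [case: tplegma|case: (tP j)].
  move=> /(gen2 k l t a kl tplegma GN)/(_ a1).
  under eq_bigr do rewrite zphi//.
  by rewrite ler_norml => /andP[+ _]; lra.
have upper (s : 'I_k.+1 -> {fset nat}) :
    (forall j : 'I_k.+1, F (s j) /\ threaded B k.+1 j (s j)) ->
    `|\sum_(j < k.+1) a j *: phi (s j)| <= p1 (\sum_(j < k.+1) a j *: e1 j) + h.
  move=> sP.
  have s0 j : s j != fset0 by apply: regular_thin_neq0 rF _; case: (sP j).
  have FN j : restr F N (s j) by case: (sP j) => Fs sB; exact: thr_restr Fs sB.
  have spl : plegma s by apply: (threaded_plegma B) => // j; case: (sP j).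
  have := thr_start s s0 (fun j => (sP j).2).
  move=> /(gen1 k l s a kl spl FN)/(_ a1).
  under eq_bigr do rewrite -sub.2//.
  by rewrite ler_norml => /andP[_]; lra.
apply: le_trans lower _.
(* The sets [s] can be chosen independently for each [j]: threads interlace, so every choice is
   plegma and [upper] applies. *)
have := norm_sum_replace k.+1
  (fun j => [set w | exists2 s, F s /\ threaded B k.+1 j s & w = a j *: phi s])
  (fun j => a j *: phi (t j)) h.
move=> /(_ _ 0 (p1 (\sum_(j < k.+1) a j *: e1 j) + h)).
move=> bound; have /bound : forall (j : 'I_k.+1) y c,
    (forall w, (exists2 s, F s /\ threaded B k.+1 j s & w = a j *: phi s) ->
       `|w + y| <= c) ->
    `|a j *: phi (t j) + y| <= c + h.
  move=> j y c wc; have [Gt tB] := tP j; have [_ [_ _ cF] _] := rF.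
  apply: (threaded_bound F N phi B k.+1 j h) => //.
  - by move=> r n /BN[].
  - by move=> r u ur; exact: (BP r u ur).2.
  - exact: GF (GN j).
  - by rewrite ler_norml.
  - by move=> s Fs sB; apply: wc; exists s.
have Eh : e = h * k.+1%:R + 2 * h.
  by rewrite [2 * h]mulrC -mulrDr -natrD addn2 divfK// pnatr_eq0.
move=> {}bound; rewrite Eh.
suff : `|\sum_(j < k.+1) a j *: phi (t j) + 0|
   <= p1 (\sum_(j < k.+1) a j *: e1 j) + h + k.+1%:R * h by rewrite addr0; lra.
apply: bound => w /(_ _)/cid2-/all_sig2[s sP ws].
by rewrite addr0; under eq_bigr do rewrite ws; exact: upper.
Unshelve. all: by end_near.
Qed.

(* Hamel bases are indexed by nat, so E1 and E2 are infinite-dimensional. *)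
Theorem theorem0p27 (R : realType) (X : completeNormedModType R)
    (F G : set {fset nat}) (N : set nat)
    (x phi z : {fset nat} -> X)
    (E1 E2 : lmodType R) (p1 : E1 -> R) (p2 : E2 -> R)
    (e1 : nat -> E1) (e2 : nat -> E2) :
  regular_thin F -> regular_thin G ->
  infinite_set N ->
  (forall t, restr G N t -> exists2 s, F s & initial_segment t s) ->
  [bounded x s | s in F] ->
  subordinated_by F N x phi ->
  (forall v, restr G N v -> z v = phi v) ->
  seminorm p1 -> hamel_basis e1 ->
  seminorm p2 -> hamel_basis e2 ->
  generates_spreading_model F N x p1 e1 ->
  generates_spreading_model G N z p2 e2 ->
  forall (k : nat) (a : 'I_k.+1 -> R),
    p2 (\sum_(j < k.+1) a j *: e2 j) <= p1 (\sum_(j < k.+1) a j *: e1 j).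
Proof.
move=> rF rG Ninf GF _ sub zphi [_ _ p1Z] _ [_ _ p2Z] _ gen1 gen2 k a.
(* The generating inequalities only concern coefficients in [-1, 1]. *)
pose c := 1 + \sum_j `|a j|.
have c0 : 0 < c by rewrite ltr_pwDl// sumr_ge0.
have ac j : -1 <= c^-1 * a j <= 1.
  rewrite -ler_norml normrM gtr0_norm ?invr_gt0// ler_pdivrMl// mulr1.
  rewrite /c (bigD1 j)//= addrCA lerDl addr_ge0// sumr_ge0//.
have := spreading_model_le F G N x phi z E1 E2 p1 p2 e1 e2 k _
  rF rG Ninf GF sub zphi gen1 gen2 ac.
(* By homogeneity of the seminorms the factor [c^-1] cancels on both sides. *)
have scale (E : lmodType R) (e : nat -> E) :
    \sum_(j < k.+1) (c^-1 * a j) *: e j = c^-1 *: \sum_(j < k.+1) a j *: e j.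
  by rewrite scaler_sumr; apply: eq_bigr => j _; rewrite scalerA.
by rewrite !scale p1Z p2Z ler_pM2l// normr_gt0 invr_eq0 gt_eqF.
Qed.
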